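(* Let $c_L,c_{L,I}\in\mathbb C$ with $c_{L,I}\ne0$. Let $\mathcal V^{\rm ext}=L^{\mathcal H}(c_L,c_{L,I})\oplus\mathcal U$ and, for $i=0,1$, let $S_i(z)=Y_{\rm ext}(v^i,z)=\sum_{n\in\mathbb Z}S_i(n)z^{-n-1}$, as defined in the context. Then for all $n,m\in\mathbb Z$: $$[L(n),S_i(m)]=-mS_i(n+m)\quad(i=0,1),$$ $$[W(n),S_0(m)]=0,\qquad [W(n),S_1(m)]=2m\,c_{L,I}\,S_0(n+m).$$ In particular, $S_0(0)$ and $S_1(0)$ are screening operators, i.e. they commute with all $L(n)$ and $W(n)$, $n\in\mathbb Z$. Moreover, $S_1=S_1(0)$ restricts to a nontrivial map $$S_1\colon L^{\mathcal H}(c_L,c_{L,I})\to L^{\mathcal H}(1,0),$$ where $L^{\mathcal H}(1,0)$ is identified with the submodule $U(\mathcal H)v^0\subset\mathcal U$, and $S_1(0)I(-1)\mathbf 1=-v^0$.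
   Context: **Twisted Heisenberg--Virasoro algebra $\mathcal H$**: complex Lie algebra with basis $\{L(n),I(n): n\in\mathbb Z\}\cup\{C_L,C_{LI},C_I\}$ and brackets $[L(n),L(m)]=(n-m)L(n+m)+\delta_{n,-m}\frac{n^3-n}{12}C_L$, $[L(n),I(m)]=-mI(n+m)-\delta_{n,-m}(n^2+n)C_{LI}$, $[I(n),I(m)]=n\delta_{n,-m}C_I$, with $C_L,C_{LI},C_I$ central. Put $\mathcal H^{+}=\operatorname{span}\{I(n),L(n):n>0\}$, $\mathcal H^0=\operatorname{span}\{I(0),L(0),C_L,C_{LI},C_I\}$, $\mathcal H^{\ge0}=\mathcal H^0\oplus\mathcal H^+$. $L^{\mathcal H}(h,h_I)$ is the irreducible highest weight $\mathcal H$-module on whose highest weight vector (killed by $\mathcal H^+$) $C_L,C_I,C_{LI},L(0),I(0)$ act by $c_L,0,c_{L,I},h,h_I$. $L^{\mathcal H}(c_L,c_{L,I}):=L^{\mathcal H}(0,0)$, with highest weight vector $\mathbf 1$, is a simple vertex operator algebra generated by $Y(L(-2)\mathbf 1,z)=\sum L(n)z^{-n-2}$ and $Y(I(-1)\mathbf 1,z)=\sum I(n)z^{-n-1}$; restricted $\mathcal H$-modules with $C_L=c_L,C_I=0,C_{LI}=c_{L,I}$ are modules for it. In it put $W=(I(-1)^2+2c_{L,I}I(-2))\mathbf 1$ and $Y(W,z)=\sum_{n\in\mathbb Z}W(n)z^{-n-2}$; explicitly $W(n)=-2c_{L,I}(n+1)I(n)+\sum_{i\in\mathbb Z}I(-i)I(n+i)$.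 The operators $L(n),W(n)$ define a representation of the Lie algebra $W(2,2)$, with relations $[L(n),W(m)]=(n-m)W(n+m)+\delta_{n,-m}\frac{n^3-n}{12}c_W$, $[W(n),W(m)]=0$, $c_W=-24c_{L,I}^2$. **The module $\mathcal U$**: let $E=\operatorname{span}_{\mathbb C}\{v^0,v^1\}$ be the 2-dimensional $\mathcal H^{\ge0}$-module on which $\mathcal H^+$ acts by zero, $L(0)v^i=v^i$, $I(0)v^1=v^0$, $I(0)v^0=0$, $C_Lv^i=c_Lv^i$, $C_{LI}v^i=c_{L,I}v^i$, $C_Iv^i=0$ ($i=0,1$). Let $\widetilde E=U(\mathcal H)\otimes_{U(\mathcal H^{\ge0})}E$ and $\mathcal U=\widetilde E/\,U(\mathcal H)\big(L(-1)+\tfrac{1}{c_{L,I}}I(-1)\big)v^0$, a module for $L^{\mathcal H}(c_L,c_{L,I})$; the submodule $U(\mathcal H)v^0$ of $\mathcal U$ is isomorphic to $L^{\mathcal H}(1,0)$. **The vertex algebra $\mathcal V^{\rm ext}$**: $\mathcal V^{\rm ext}=L^{\mathcal H}(c_L,c_{L,I})\oplus\mathcal U$ is a vertex operator algebra with $Y_{\rm ext}(a_1+w_1,z)(a_2+w_2)=Y(a_1,z)(a_2+w_2)+e^{zL(-1)}Y(a_2,-z)w_1$ for $a_1,a_2\in L^{\mathcal H}(c_L,c_{L,I})$, $w_1,w_2\in\mathcal U$. All commutators are of operators on $\mathcal V^{\rm ext}$. *)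

(* Defs.v *)
From HB Require Import structures.
From mathcomp Require Import all_boot all_order all_algebra.
From mathcomp Require Import all_classical reals.
From mathcomp Require Import complex.

Set Implicit Arguments.
Unset Strict Implicit.
Unset Printing Implicit Defensive.

Import Order.TTheory GRing.Theory Num.Theory.

Local Open Scope classical_set_scope.
Local Open Scope ring_scope.

Definition commutator (V : zmodType) (f g : V -> V) (x : V) : V :=
  f (g x) - g (f x).

(** * The twisted Heisenberg--Virasoro Lie algebra and its modules *)

(* The standard basis: L(n), I(n), C_L, C_{LI}, C_I. *)
Inductive hvir : Type :=
  | hL of int
  | hI of int
  | hCL
  | hCLI
  | hCI.

(* [hbracket x y] is the bracket of two basis elements, as a formal linear
   combination of basis elements. *)
Definition hbracket (K : numFieldType) (x y : hvir) : seq (K * hvir) :=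
  match x, y with
  | hL n, hL m =>
      [:: ((n - m)%:~R, hL (n + m));
          (if n == - m then (n ^+ 3 - n)%:~R / 12%:R else 0, hCL)]
  | hL n, hI m =>
      [:: ((- m)%:~R, hI (n + m));
          (if n == - m then - (n ^+ 2 + n)%:~R else 0, hCLI)]
  | hI m, hL n =>
      [:: (m%:~R, hI (n + m));
          (if n == - m then (n ^+ 2 + n)%:~R else 0, hCLI)]
  | hI n, hI m => [:: (if n == - m then n%:~R else 0, hCI)]
  | _, _ => [::]
  end.

(* The spanning basis elements of H^+ and of H^{>=0}. *)
Definition hpos (x : hvir) : bool :=
  match x with hL n | hI n => 0 < n | _ => false end.

Definition hnonneg (x : hvir) : bool :=
  match x with hL n | hI n => 0 <= n | _ => true end.

Section Modules.
Variable K : numFieldType.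

(* A representation of H is given by the images of the basis elements. *)
Definition hmodule (V : lmodType K) (rho : hvir -> {linear V -> V}) : Prop :=
  forall (x y : hvir) (v : V),
    commutator (rho x) (rho y) v
    = \sum_(t <- hbracket K x y) t.1 *: rho t.2 v.

Definition hhom (V N : lmodType K) (rhoV : hvir -> {linear V -> V})
    (rhoN : hvir -> {linear N -> N}) (f : {linear V -> N}) : Prop :=
  forall (x : hvir) (v : V), f (rhoV x v) = rhoN x (f v).

Record hsubmodule (V : lmodType K) (rho : hvir -> {linear V -> V})
    (S : set V) : Prop := HSubmodule {
  hsub_zero : S 0;
  hsub_lin : forall (k : K) (u v : V), S u -> S v -> S (k *: u + v);
  hsub_act : forall (x : hvir) (v : V), S v -> S (rho x v) }.

(* U(H) v *)
Definition hgen (V : lmodType K) (rho : hvir -> {linear V -> V}) (v : V)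
    : set V :=
  [set u | forall S : set V, hsubmodule rho S -> S v -> S u].

(* (V, rho) is an irreducible highest weight module with highest weight vector
   v, on which C_L, C_I, C_{LI}, L(0), I(0) act by cL, 0, cLI, h, h_I.  This
   determines it up to isomorphism: it is L^H(h, h_I). *)
Record irr_highest_weight (cL cLI h h_I : K) (V : lmodType K)
    (rho : hvir -> {linear V -> V}) (v : V) : Prop := IrrHighestWeight {
  ihw_module : hmodule rho;
  ihw_neq0 : v != 0;
  ihw_pos : forall x : hvir, hpos x -> rho x v = 0;
  ihw_CL : rho hCL v = cL *: v;
  ihw_CI : rho hCI v = 0;
  ihw_CLI : rho hCLI v = cLI *: v;
  ihw_L0 : rho (hL 0) v = h *: v;
  ihw_I0 : rho (hI 0) v = h_I *: v;
  ihw_gen : hgen rho v = setT;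
  ihw_irr : forall S : set V, hsubmodule rho S -> S = [set 0] \/ S = setT }.

(** * The module U *)

(* E = span {v^0, v^1}, with basis the two unit row vectors. *)
Definition vE (i : 'I_2) : 'rV[K]_2 := delta_mx 0 i.

(* The action of H^{>=0} on E; the values at basis elements outside H^{>=0}
   are irrelevant and set to 0. *)
Definition actE (cL cLI : K) (x : hvir) (e : 'rV[K]_2) : 'rV[K]_2 :=
  match x with
  | hL n => if n == 0 then e else 0
  | hI n => if n == 0 then e 0 1 *: vE 0 else 0
  | hCL => cL *: e
  | hCLI => cLI *: e
  | hCI => 0
  end.

Definition nonneg_hom (cL cLI : K) (N : lmodType K)
    (rho : hvir -> {linear N -> N}) (f : {linear 'rV[K]_2 -> N}) : Prop :=
  forall (x : hvir) (e : 'rV[K]_2),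
    hnonneg x -> f (actE cL cLI x e) = rho x (f e).

(* (N, rho) with iota : E -> N, e |-> 1 (x) e, is the induced module
   U(H) (x)_{U(H^{>=0})} E: extension of scalars, i.e. every H^{>=0}-map from E
   to an H-module factors uniquely through iota by an H-map. *)
Record inducedE (cL cLI : K) (N : lmodType K) (rho : hvir -> {linear N -> N})
    (iota : {linear 'rV[K]_2 -> N}) : Prop := InducedE {
  ind_module : hmodule rho;
  ind_hom : nonneg_hom cL cLI rho iota;
  ind_univ : forall (P : lmodType K) (rhoP : hvir -> {linear P -> P})
      (f : {linear 'rV[K]_2 -> P}),
    hmodule rhoP -> nonneg_hom cL cLI rhoP f ->
    (exists2 g : {linear N -> P},
       hhom rho rhoP g & forall e, g (iota e) = f e) /\
    (forall g1 g2 : {linear N -> P}, hhom rho rhoP g1 -> hhom rho rhoP g2 ->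
       (forall e, g1 (iota e) = g2 (iota e)) -> forall x, g1 x = g2 x) }.

(* (U, rho) is the quotient of the induced module by the submodule generated by
   (L(-1) + cLI^{-1} I(-1)) v^0, and j : E -> U is the canonical map. *)
Definition is_calU (cL cLI : K) (U : lmodType K)
    (rho : hvir -> {linear U -> U}) (j : {linear 'rV[K]_2 -> U}) : Prop :=
  hmodule rho /\
  exists (Et : lmodType K) (rhoE : hvir -> {linear Et -> Et})
    (iota : {linear 'rV[K]_2 -> Et}) (p : {linear Et -> U}),
  [/\ inducedE cL cLI rhoE iota,
      hhom rhoE rho p,
      range p = setT,
      [set x | p x = 0]
        = hgen rhoE (rhoE (hL (- 1)) (iota (vE 0))
                     + cLI^-1 *: rhoE (hI (- 1)) (iota (vE 0)))
    & forall e, j e = p (iota e)].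

(** * Vertex operator algebras and their modules *)

(* C(p, j) for p an integer *)
Definition binz (p : int) (j : nat) : K :=
  (\prod_(i < j) (p - i%:Z)%:~R) / j`!%:R.

(* A vertex operator map is encoded by its modes:
   Y(a, z) = \sum_n (Y a n) z^{-n-1}. *)
Definition modes_bilinear (V M : lmodType K) (Y : V -> int -> M -> M) : Prop :=
  (forall (k : K) (a b : V) (n : int) (u : M),
     Y (k *: a + b) n u = k *: Y a n u + Y b n u) /\
  (forall (k : K) (a : V) (n : int) (u w : M),
     Y a n (k *: u + w) = k *: Y a n u + Y a n w).

Definition modes_truncated (V M : lmodType K) (Y : V -> int -> M -> M) : Prop :=
  forall (a : V) (u : M), exists N : int, forall n : int, N <= n -> Y a n u = 0.

(* The Jacobi identity in terms of modes (Borcherds identity).  The summands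
   vanish for large j when Y and YM are truncated, and [\sum_(j \in A)] is the
   sum of a finitely supported family. *)
Definition borcherds (V M : lmodType K) (Y : V -> int -> V -> V)
    (YM : V -> int -> M -> M) : Prop :=
  forall (a b : V) (u : M) (p q r : int),
    \sum_(j \in [set: nat])
       binz p j *: YM (Y a (r + j%:Z) b) (p + q - j%:Z) u
    = \sum_(j \in [set: nat])
       ((-1) ^+ j * binz r j) *:
         (YM a (p + r - j%:Z) (YM b (q + j%:Z) u)
          - (-1) ^ r *: YM b (q + r - j%:Z) (YM a (p + j%:Z) u)).

Record vertex_algebra (V : lmodType K) (Y : V -> int -> V -> V) (vac : V)
    : Prop := VertexAlgebra {
  va_bilinear : modes_bilinear Y;
  va_truncated : modes_truncated Y;
  va_vacuum : forall (n : int) (b : V), Y vac n b = if n == - 1 then b else 0;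
  va_creation : forall (a : V) (n : int), 0 <= n -> Y a n vac = 0;
  va_creation1 : forall a : V, Y a (- 1) vac = a;
  va_borcherds : borcherds Y Y }.

(* omega is the conformal vector, L(n) = omega_{n+1}, and c is the central
   charge; the weight spaces are the eigenspaces of L(0). *)
Record vertex_operator_algebra (c : K) (V : lmodType K)
    (Y : V -> int -> V -> V) (vac omega : V) : Prop := VertexOperatorAlgebra {
  voa_va : vertex_algebra Y vac;
  voa_virasoro : forall (n m : int) (v : V),
    commutator (Y omega (n + 1)) (Y omega (m + 1)) v
    = (n - m)%:~R *: Y omega (n + m + 1) v
      + (if n == - m then ((n ^+ 3 - n)%:~R / 12%:R * c) *: v else 0);
  voa_derivative : forall (a : V) (n : int) (v : V),
    Y (Y omega 0 a) n v = (- n)%:~R *: Y a (n - 1) v;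
  voa_graded : forall v : V, exists s : seq (int * V),
    v = \sum_(t <- s) t.2 /\
    forall t, t \in s -> Y omega 1 t.2 = t.1%:~R *: t.2;
  voa_finite : forall n : int, exists s : seq V, forall v : V,
    Y omega 1 v = n%:~R *: v ->
    exists k : 'I_(size s) -> K, v = \sum_(i < size s) k i *: s`_i;
  voa_bounded : exists n0 : int, forall (n : int) (v : V),
    n < n0 -> Y omega 1 v = n%:~R *: v -> v = 0 }.

Record voa_module (V : lmodType K) (Y : V -> int -> V -> V) (vac : V)
    (M : lmodType K) (YM : V -> int -> M -> M) : Prop := VOAModule {
  vm_bilinear : modes_bilinear YM;
  vm_truncated : modes_truncated YM;
  vm_vacuum : forall (n : int) (u : M),
    YM vac n u = if n == - 1 then u else 0;
  vm_borcherds : borcherds Y YM }.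

(* The fields of L(-2) vac and I(-1) vac on (M, rho) are
   \sum L(n) z^{-n-2} and \sum I(n) z^{-n-1}. *)
Definition generating_fields (V : lmodType K) (rhoV : hvir -> {linear V -> V})
    (vac : V) (M : lmodType K) (rhoM : hvir -> {linear M -> M})
    (YM : V -> int -> M -> M) : Prop :=
  (forall (n : int) (u : M),
     YM (rhoV (hL (- 2)) vac) (n + 1) u = rhoM (hL n) u) /\
  (forall (n : int) (u : M),
     YM (rhoV (hI (- 1)) vac) n u = rhoM (hI n) u).

(** * The extension V^ext = V (+) U *)

Section Extension.
Variables (V U : lmodType K).
Variables (rhoV : hvir -> {linear V -> V}) (rhoU : hvir -> {linear U -> U}).
Variables (YV : V -> int -> V -> V) (YU : V -> int -> U -> U).

(* Coefficient of z^{-n-1} in e^{zL(-1)} Y(a, -z) w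
   = \sum_{j >= 0} \sum_k (z^j / j!) L(-1)^j (-z)^{-k-1} a_k w :
   only k = n + j contributes, and the summands vanish for large j. *)
Definition skewY (w : U) (n : int) (a : V) : U :=
  \sum_(j \in [set: nat])
    ((-1) ^ (- (n + j%:Z) - 1) / j`!%:R) *:
      iter j (rhoU (hL (- 1))) (YU a (n + j%:Z) w).

Definition Yext (x : V * U) (n : int) (y : V * U) : V * U :=
  (YV x.1 n y.1, YU x.1 n y.2 + skewY x.2 n y.1).

Definition Lext (n : int) (y : V * U) : V * U :=
  (rhoV (hL n) y.1, rhoU (hL n) y.2).

Definition Wvec (cLI : K) (vac : V) : V :=
  rhoV (hI (- 1)) (rhoV (hI (- 1)) vac)
  + (2%:R * cLI) *: rhoV (hI (- 2)) vac.

(* Y(W, z) = \sum_n W(n) z^{-n-2} *)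
Definition Wext (cLI : K) (vac : V) (n : int) : V * U -> V * U :=
  Yext (Wvec cLI vac, 0) (n + 1).

(* S_i(z) = Y_ext(v^i, z) = \sum_n S_i(n) z^{-n-1} *)
Definition Sext (j : {linear 'rV[K]_2 -> U}) (i : 'I_2) (n : int)
    : V * U -> V * U :=
  Yext (0, j (vE i)) n.

End Extension.
End Modules.

(* Main.v *)
(* Skew-symmetry makes Y(w,z)a = e^{zD} Y(a,-z)w an intertwining operator: for
   b in V and w in U,
     [b_k, w_m] = \sum_i C(k,i) (b_i w)_{k+m-i}  and  (Dw)_m = -m w_{m-1},
   so the commutators only depend on the vectors b_i v^0, b_i v^1 with i >= 0.
   These are: L(-1) v^i, L(0) v^i = v^i; W_i v^0 = 0; W_1 v^1 = -2c v^0 and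
   W_0 v^1 = 2 I(-1) I(0) v^1 = 2 I(-1) v^0 = -2c L(-1) v^0 (c = c_{L,I},
   W_k = W(k-1)), where the last step is the relation defining U.  For the image
   of S_1(0), which kills the vacuum: it commutes with L(n), and
   [I(n), S_1(0)] = S_0(n) takes values in the V-submodule U(H) v^0. *)
Require Import Defs.
From HB Require Import structures.
From mathcomp Require Import all_boot all_order all_algebra.
From mathcomp Require Import all_classical reals.
From mathcomp Require Import complex.
From mathcomp Require Import ring zify.

Set Implicit Arguments.
Unset Strict Implicit.
Unset Printing Implicit Defensive.

Import Order.TTheory GRing.Theory Num.Theory.

Local Open Scope classical_set_scope.
Local Open Scope ring_scope.

(** * Truncation and reindexing of finitely supported sums *)

Lemma fsbig_nat_trunc (V : zmodType) (F : nat -> V) (N : nat) :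
  (forall i, (N <= i)%N -> F i = 0) ->
  \sum_(i \in [set: nat]) F i = \sum_(i < N) F i.
Proof.
move=> F0; rewrite fsbig_ord; apply/esym/fsbig_widen => //.
by move=> i [_ /= /negP]; rewrite -leqNgt => /F0.
Qed.

Lemma sum_ord_trunc (V : zmodType) (F : nat -> V) (J N : nat) :
  (J <= N)%N -> (forall i, (J <= i)%N -> F i = 0) ->
  \sum_(i < J) F i = \sum_(i < N) F i.
Proof.
move=> JN F0; rewrite -(fsbig_nat_trunc F0); apply: fsbig_nat_trunc => i Ni.
exact/F0/(leq_trans JN).
Qed.

(** With [l = j - i] the left side runs over the triangle [i + l < N]; the rest of the square on the
    right contributes only zeros. *)
Lemma sum_triangle (V : zmodType) (G : nat -> nat -> V) (N : nat) :
  (forall i l, (N <= i + l)%N -> G i l = 0) ->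
  \sum_(j < N) \sum_(i < j.+1) G i (j - i)%N
  = \sum_(l < N) \sum_(i < N) G i l.
Proof.
move=> G0; rewrite [RHS]exchange_big /=.
under eq_bigr => j _ do
  rewrite (big_ord_widen _ (fun i => G i (j - i)%N) (ltn_ord j)).
rewrite (exchange_big_dep xpredT) //=; apply: eq_bigr => i _.
rewrite -(@sum_ord_trunc _ (G i) (N - i) N) ?leq_subr //; last first.
  by move=> l; rewrite leq_subLR => /G0.
rewrite -[RHS](big_mkord xpredT) -(add0n (i : nat)).
rewrite -(big_mkord (fun j => i < j.+1)%N (fun j => G i (j - i)%N)).
rewrite (big_cat_nat (n := i)) ?(ltnW (ltn_ord i)) //= big_nat_cond.
rewrite big1 ?add0r; last by move=> j; lia.
rewrite -{1}(add0n (i : nat)) big_addn big_nat_cond [RHS]big_nat_cond.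
apply: eq_big => [l|l _]; first by lia.
by rewrite addnK.
Qed.

(** * Divided powers of an operator *)

Section DividedPowers.
Variables (K : numFieldType) (U : lmodType K) (D : {linear U -> U}).

(** The coefficient of $z^j$ in $e^{zD}$. *)
Definition dpow (j : nat) (u : U) : U := j`!%:R^-1 *: iter j D u.

Fact dpow_is_linear (j : nat) : linear (dpow j).
Proof.
move=> k u v; rewrite /dpow.
have -> : iter j D (k *: u + v) = k *: iter j D u + iter j D v.
  by elim: j => //= j ->; rewrite linearP.
by rewrite scalerDr !scalerA mulrC.
Qed.

HB.instance Definition _ (j : nat) :=
  GRing.isLinear.Build K U U *:%R (dpow j) (dpow_is_linear j).

Lemma dpow0 (u : U) : dpow 0 u = u.
Proof. by rewrite /dpow /= invr1 scale1r. Qed.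

Lemma dpowS (j : nat) (u : U) : j.+1%:R *: dpow j.+1 u = dpow j (D u).
Proof.
rewrite /dpow scalerA factS natrM invfM mulrA divff ?pnatr_eq0 // mul1r.
by rewrite iterSr.
Qed.

End DividedPowers.

(** * Binomial coefficients with integer upper index *)

Section Binz.
Variable K : numFieldType.

Lemma binz0 (k : int) : binz K k 0 = 1.
Proof. by rewrite /binz big_ord0 divr1. Qed.

Lemma binzS (k : int) (j : nat) :
  j.+1%:R * binz K k j.+1 = (k - j%:Z)%:~R * binz K k j.
Proof.
rewrite /binz big_ord_recr /= factS natrM.
have jn : j.+1%:R != 0 :> K by rewrite pnatr_eq0.
have fn : j`!%:R != 0 :> K by rewrite pnatr_eq0 -lt0n fact_gt0.
move: (_%:~R) (\prod_(_ < _) _) jn fn => x p.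
move: (j.+1%:R) (j`!%:R) => s t jn fn.
by field; rewrite jn fn.
Qed.

Lemma binz1 (k : int) : binz K k 1 = k%:~R.
Proof. by have := binzS k 0; rewrite mul1r binz0 mulr1 subr0. Qed.

Lemma binz0l (j : nat) : (0 < j)%N -> binz K 0 j = 0.
Proof. by case: j => // j _; rewrite /binz big_ord_recl subrr !mul0r. Qed.

Lemma binzN2 (j : nat) : binz K (- 2) j = (-1) ^+ j * j.+1%:R.
Proof.
elim: j => [|j IH]; first by rewrite binz0 mulr1.
have jn : j.+1%:R != 0 :> K by rewrite pnatr_eq0.
apply: (mulfI jn); rewrite binzS IH exprS.
rewrite (_ : (-2 - j%:Z)%:~R = - j.+2%:R); first by ring.
by rewrite -opprD rmorphN /= -PoszD add2n.
Qed.

End Binz.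

(** * Linearity and truncation of modes *)

Section LinearPack.
Variables (K : numFieldType) (V M : lmodType K) (f : V -> M).

(** An alias that carries a proof of linearity, so that a map shown linear inside a proof can
    receive a [{linear V -> M}] structure. *)
Definition linear_pack of linear f := f.

HB.instance Definition _ (lin_f : linear f) :=
  GRing.isLinear.Build K V M *:%R (linear_pack lin_f) lin_f.

End LinearPack.

Section Modes.
Variables (K : numFieldType) (V M : lmodType K) (Y : V -> int -> M -> M).
Hypothesis bilY : modes_bilinear Y.

Lemma modes_linear (a : V) (n : int) :
  exists f : {linear M -> M}, Y a n =1 f.
Proof.
pose g := Y a n; have lin_g : linear g by move=> k u w; exact: bilY.2.
by exists (linear_pack lin_g).
Qed.

Lemma modes_linearl (n : int) (u : M) :
  exists f : {linear V -> M}, forall a, Y a n u = f a.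
Proof.
pose g a := Y a n u; have lin_g : linear g by move=> k a b; exact: bilY.1.
by exists (linear_pack lin_g).
Qed.

Lemma modes0 (a : V) (n : int) : Y a n 0 = 0.
Proof. by have [f ->] := modes_linear a n; rewrite linear0. Qed.

Lemma modes0l (n : int) (u : M) : Y 0 n u = 0.
Proof. by have [f ->] := modes_linearl n u; rewrite linear0. Qed.

Hypothesis truncY : modes_truncated Y.

Lemma modes_trunc_nat (a : V) (u : M) (q : int) :
  exists N : nat, forall i, (N <= i)%N -> Y a (q + i%:Z) u = 0.
Proof.
have [N YN] := truncY a u; exists `|N - q|%N => i Ni; apply: YN; lia.
Qed.

End Modes.

(** * The intertwining field $e^{zD}Y(a,-z)w$ *)

Section SkewModes.
Variables (K : numFieldType) (V U : lmodType K) (vac omega : V).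
Variables (YV : V -> int -> V -> V) (YU : V -> int -> U -> U).
Variable rhoU : hvir -> {linear U -> U}.
Hypothesis va : vertex_algebra YV vac.
Hypothesis derV : forall (a : V) (n : int) (v : V),
  YV (YV omega 0 a) n v = (- n)%:~R *: YV a (n - 1) v.
Hypothesis vmU : voa_module YV vac YU.
Let D := rhoU (hL (- 1)).
Hypothesis omega0 : forall u : U, YU omega 0 u = D u.

Let bilU := vm_bilinear vmU.
Let truncU := vm_truncated vmU.

(** The Borcherds identity at [p = 0]: since $C(0,j)=0$ for $j>0$, its left side is the single mode
    $(a_r b)_q$. *)
Lemma borcherds_iterate (a b : V) (r q : int) (u : U) (N : nat) :
  (forall i, (N <= i)%N -> YU b (q + i%:Z) u = 0) ->
  (forall i, (N <= i)%N -> YU a i%:Z u = 0) ->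
  YU (YV a r b) q u =
  \sum_(i < N) ((-1) ^+ i * binz K r i) *:
     (YU a (r - i%:Z) (YU b (q + i%:Z) u)
      - (-1) ^ r *: YU b (q + r - i%:Z) (YU a i%:Z u)).
Proof.
move=> b0 a0; have := vm_borcherds vmU a b u 0 q r.
rewrite (@fsbig_nat_trunc _ _ 1); last first.
  by case=> // i _; rewrite binz0l // scale0r.
rewrite big_ord1 binz0 scale1r addr0 add0r subr0 => ->.
rewrite (@fsbig_nat_trunc _ _ N).
  by apply: eq_bigr => i _; rewrite !add0r.
move=> i Ni; rewrite b0 // add0r a0 // !(modes0 bilU).
by rewrite scaler0 subr0 scaler0.
Qed.

(** Every product in the iterate formula for $b_{-2}\mathbf 1$ contains a mode of the vacuum, which
    vanishes unless its index is $-1$; at most one summand survives. *)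
Lemma modes_translate (b : V) (n : int) (u : U) :
  YU (YV b (- 2) vac) n u = (- n)%:~R *: YU b (n - 1) u.
Proof.
have [N1 b0] := modes_trunc_nat truncU b u 0.
pose N := maxn N1 `|n|.+1.
rewrite (@borcherds_iterate _ _ _ _ _ N); last 2 first.
- by move=> i; rewrite /N (vm_vacuum vmU); case: eqP => //; lia.
- by move=> i Ni; rewrite -[i%:Z]add0r b0 // (leq_trans _ Ni) ?leq_maxl.
(* The surviving index is $-n-1$ (first product, $n<0$) or $n-1$ (second product, $n>0$), that is
   $|n|-1$ in both cases; for $n=0$ neither is a natural number. *)
have key (i : nat) : ((-1) ^+ i * binz K (- 2) i) *:
     (YU b (- 2 - i%:Z) (YU vac (n + i%:Z) u)
      - (-1) ^ (- 2) *: YU vac (n - 2 - i%:Z) (YU b i%:Z u))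
   = (if (i%:Z == - n - 1) || (i%:Z == n - 1) then (- n)%:~R *: YU b (n - 1) u
      else 0).
  rewrite binzN2 mulrA -expr2 sqrr_sign mul1r !(vm_vacuum vmU).
  rewrite (_ : (-1) ^ (- 2) = 1 :> K) ?scale1r; last first.
    by rewrite expN1r -[absz _]/2%N sqrrN expr1n.
  case: (eqVneq i%:Z (- n - 1)) => [ni|ni] /=.
    rewrite ifT; last by rewrite ni; lia.
    rewrite ifF ?subr0; last by lia.
    rewrite (_ : i.+1%:R = (- n)%:~R); first by congr (_ *: YU _ _ _); lia.
    by rewrite pmulrn; congr (_%:~R); lia.
  rewrite ifF; last by lia.
  rewrite (modes0 bilU) add0r.
  case: (eqVneq i%:Z (n - 1)) => [ni'|ni'].
    rewrite ifT; last by lia.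
    rewrite scalerN -scaleNr ni'; congr (_ *: _).
    by rewrite pmulrn -rmorphN; congr (_%:~R); lia.
  by rewrite ifF ?oppr0 ?scaler0 //; lia.
under eq_bigr do rewrite key.
case: (posnP `|n|) => [n0|n0].
  have -> : n = 0 by lia.
  rewrite oppr0 scale0r big1 // => i _; rewrite ifF //; lia.
have in0 : (`|n|.-1 < N)%N by rewrite /N; lia.
rewrite (bigD1 (Ordinal in0)) //= ifT; last by lia.
rewrite big1 ?addr0 // => i /eqP ne; rewrite ifF //.
apply/negbTE/negP => ii; apply: ne; apply: val_inj => /=; lia.
Qed.

(** At [p = r = 0] the Borcherds identity reads $(\omega_0 b)_n=[D,b_n]$. The derivative property on
    $V$, applied to the vacuum at mode $-1$, gives $\omega_0 b=b_{-2}\mathbf 1$, and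
    [modes_translate] finishes. *)
Lemma modes_derivation (b : V) (n : int) (u : U) :
  D (YU b n u) = YU b n (D u) + (- n)%:~R *: YU b (n - 1) u.
Proof.
have Dn : YU (YV omega 0 b) n u = D (YU b n u) - YU b n (D u).
  have := vm_borcherds vmU omega b u 0 n 0.
  rewrite (@fsbig_nat_trunc _ _ 1); last first.
    by case=> // i _; rewrite binz0l // scale0r.
  rewrite big_ord1 binz0 scale1r !addr0 add0r => ->.
  rewrite (@fsbig_nat_trunc _ _ 1); last first.
    by case=> // i _; rewrite binz0l // mulr0 scale0r.
  by rewrite big_ord1 binz0 mulr1 scale1r ?addr0 expr0z scale1r !omega0.
rewrite -[LHS](subrK (YU b n (D u))) -Dn addrC; congr (_ + _).
have -> : YV omega 0 b = YV b (- 2) vac.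
  by rewrite -[LHS](va_creation1 va) derV opprK scale1r.
exact: modes_translate.
Qed.

(** The coefficient of $z^j$ in $b_k e^{zD}=e^{zD}\sum_i C(k,i)z^i b_{k-i}$, by induction after
    multiplication by $j+1$. *)
Lemma modes_dpow (b : V) (k : int) (j : nat) (u : U) :
  YU b k (dpow D j u)
  = \sum_(i < j.+1) binz K k i *: dpow D (j - i) (YU b (k - i%:Z) u).
Proof.
elim: j u => [|j IH] u.
  by rewrite big_ord1 binz0 scale1r !dpow0 subr0.
have jn : j.+1%:R != 0 :> K by rewrite pnatr_eq0.
apply: (scalerI jn).
have [f hf] := modes_linear bilU b k.
rewrite hf -linearZ -hf dpowS IH scaler_sumr.
rewrite (eq_bigr (fun i : 'I_j.+1 =>
   ((j - i).+1%:R * binz K k i) *: dpow D (j - i).+1 (YU b (k - i%:Z) u)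
   + (i.+1%:R * binz K k i.+1) *: dpow D (j - i) (YU b (k - i.+1%:Z) u)));
  last first.
  move=> i _; rewrite (_ : YU b (k - i%:Z) (D u) =
     D (YU b (k - i%:Z) u) + (k - i%:Z)%:~R *: YU b (k - i.+1%:Z) u);
    last first.
    rewrite (_ : k - i.+1%:Z = k - i%:Z - 1); last by lia.
    by rewrite modes_derivation -addrA -scalerDl -rmorphD addNr scale0r addr0.
  rewrite linearD linearZ /= -dpowS scalerDr binzS.
  by congr (_ + _); rewrite scalerA mulrC.
rewrite big_split /=.
(* Splitting $j+1=(j+1-i)+i$ separates the right side into two sums that match those on the left,
   once the zero term at $i=j+1$ is dropped from the first and the one at $i=0$ from the second. *)
rewrite [RHS](eq_bigr (fun i : 'I_j.+2 =>
   ((j.+1 - i)%N%:R * binz K k i) *: dpow D (j.+1 - i) (YU b (k - i%:Z) u)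
   + (i%:R * binz K k i) *: dpow D (j.+1 - i) (YU b (k - i%:Z) u))); last first.
  move=> i _; rewrite scalerA -scalerDl -mulrDl -natrD subnK //.
  by rewrite -ltnS ltn_ord.
rewrite big_split /= [X in _ = X + _]big_ord_recr /= subnn.
rewrite mulr0n mul0r scale0r addr0.
rewrite [X in _ = _ + X]big_ord_recl /= mulr0n mul0r scale0r add0r.
congr (_ + _); apply: eq_bigr => i _.
by rewrite subSn // -ltnS ltn_ord.
Qed.


(** The finite form used for computation; the sign exponent is replaced by one of the same
    parity. *)
Lemma skewY_trunc (w : U) (n : int) (a : V) (N : nat) :
  (forall i, (N <= i)%N -> YU a (n + i%:Z) w = 0) ->
  skewY rhoU YU w n a
  = \sum_(l < N) (-1) ^ (n + l%:Z + 1) *: dpow D l (YU a (n + l%:Z) w).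
Proof.
move=> a0; rewrite /skewY (@fsbig_nat_trunc _ _ N) => [|i /a0 ->].
  apply: eq_bigr => l _; rewrite /dpow scalerA; congr ((_ / _) *: _).
  by rewrite !expN1r -abszN opprB opprK addrC.
rewrite (_ : iter i _ 0 = 0) ?scaler0 //.
by elim: i => //= i ->; rewrite linear0.
Qed.

Lemma skewY_linear (w : U) (n : int) : linear (skewY rhoU YU w n).
Proof.
move=> k a b.
have [Na a0] := modes_trunc_nat truncU a w n.
have [Nb b0] := modes_trunc_nat truncU b w n.
pose N := maxn Na Nb.
have YN i : YU (k *: a + b) (n + i) w = k *: YU a (n + i) w + YU b (n + i) w.
  exact: bilU.1.
have aN i : (N <= i)%N -> YU a (n + i%:Z) w = 0.
  by move=> Ni; rewrite a0 // (leq_trans _ Ni) // leq_maxl.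
have bN i : (N <= i)%N -> YU b (n + i%:Z) w = 0.
  by move=> Ni; rewrite b0 // (leq_trans _ Ni) // leq_maxr.
rewrite (skewY_trunc aN) (skewY_trunc bN) (@skewY_trunc _ _ _ N); last first.
  by move=> i Ni; rewrite YN aN // bN // scaler0 addr0.
rewrite scaler_sumr -big_split /=; apply: eq_bigr => l _.
rewrite YN linearP /= scalerDr; congr (_ + _).
by rewrite scalerA [RHS]scalerA mulrC.
Qed.

Lemma skewY_linearl (n : int) (a : V) :
  linear (fun w => skewY rhoU YU w n a).
Proof.
move=> k u w.
have [Nu u0] := modes_trunc_nat truncU a u n.
have [Nw w0] := modes_trunc_nat truncU a w n.
pose N := maxn Nu Nw.
have YN i : YU a (n + i) (k *: u + w) = k *: YU a (n + i) u + YU a (n + i) w.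
  exact: bilU.2.
have uN i : (N <= i)%N -> YU a (n + i%:Z) u = 0.
  by move=> Ni; rewrite u0 // (leq_trans _ Ni) // leq_maxl.
have wN i : (N <= i)%N -> YU a (n + i%:Z) w = 0.
  by move=> Ni; rewrite w0 // (leq_trans _ Ni) // leq_maxr.
rewrite (skewY_trunc uN) (skewY_trunc wN) (@skewY_trunc _ _ _ N); last first.
  by move=> i Ni; rewrite YN uN // wN // scaler0 addr0.
rewrite scaler_sumr -big_split /=; apply: eq_bigr => l _.
rewrite YN linearP /= scalerDr; congr (_ + _).
by rewrite scalerA [RHS]scalerA mulrC.
Qed.

Lemma skewY0l (n : int) (a : V) : skewY rhoU YU 0 n a = 0.
Proof.
by rewrite -[LHS]/(linear_pack (skewY_linearl n a) 0) linear0.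
Qed.

Lemma skewYZl (k : K) (w : U) (n : int) (a : V) :
  skewY rhoU YU (k *: w) n a = k *: skewY rhoU YU w n a.
Proof. exact: (linearZ_LR (linear_pack (skewY_linearl n a))). Qed.

(** Moving $D$ to the left of the modes of $a$ turns each summand into a difference of two
    consecutive terms, with coefficients that combine to $-q$ after an index shift. *)
Lemma skewY_derivative (w : U) (q : int) (a : V) :
  skewY rhoU YU (D w) q a = (- q)%:~R *: skewY rhoU YU w (q - 1) a.
Proof.
have [N1 h1] := modes_trunc_nat truncU a (D w) q.
have [N2 h2] := modes_trunc_nat truncU a w (q - 1).
pose N := maxn N1 N2.
have hD i : (N <= i)%N -> YU a (q + i%:Z) (D w) = 0.
  by move=> Ni; rewrite h1 // (leq_trans _ Ni) // leq_maxl.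
have hw i : (N <= i)%N -> YU a (q - 1 + i%:Z) w = 0.
  by move=> Ni; rewrite h2 // (leq_trans _ Ni) // leq_maxr.
rewrite (skewY_trunc hD) (skewY_trunc hw).
(* [H l] is the $l$-th summand of [skewY] for [w] at mode [q - 1]. *)
pose H l := (-1) ^ (q + l%:Z) *: dpow D l (YU a (q - 1 + l%:Z) w).
have HN l : (N <= l)%N -> H l = 0 by move=> Nl; rewrite /H hw // linear0 scaler0.
have sgnS x : (-1) ^ (x + 1) = - (-1) ^ x :> K.
  by rewrite expfzDr ?oppr_eq0 ?oner_eq0 // expr1z mulrN1.
transitivity (\sum_(l < N) (l.+1%:R *: H l.+1 - (q + l%:Z)%:~R *: H l)).
  apply: eq_bigr => l _.
  have -> : YU a (q + l%:Z) (D w)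
      = D (YU a (q + l%:Z) w) + (q + l%:Z)%:~R *: YU a (q - 1 + l%:Z) w.
    rewrite (_ : q - 1 + l%:Z = q + l%:Z - 1); last by lia.
    by rewrite modes_derivation -addrA -scalerDl -rmorphD addNr scale0r addr0.
  rewrite linearD linearZ /= -dpowS scalerDr /H.
  rewrite (_ : q - 1 + l.+1%:Z = q + l%:Z); last by lia.
  rewrite (_ : q + l.+1%:Z = q + l%:Z + 1); last by lia.
  congr (_ + _); first by rewrite [LHS]scalerA [RHS]scalerA mulrC.
  by rewrite sgnS [in LHS]scalerA [in RHS]scalerA -scaleNr mulrC mulrN.
rewrite big_split /= sumrN.
(* Index shift: the new term at $l=0$ has factor zero, and the term at $l=N$ vanishes by
   truncation. *)
have -> : \sum_(l < N) l.+1%:R *: H l.+1 = \sum_(l < N) l%:R *: H l.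
  rewrite (@sum_ord_trunc _ (fun l => l%:R *: H l) N N.+1) //.
    by rewrite big_ord_recl /= scale0r add0r.
  by move=> i Ni; rewrite HN // scaler0.
rewrite -sumrB scaler_sumr; apply: eq_bigr => l _.
rewrite -scalerBl -[l%:R]/(l%:Z%:~R) -rmorphB.
rewrite (_ : l%:Z - (q + l%:Z) = - q); last by lia.
by rewrite (_ : q - 1 + l%:Z + 1 = q + l%:Z); last by lia.
Qed.

(* Conjugating by e^{zD} replaces b_k by \sum_i C(k,i) z^i b_{k-i}
   ([modes_dpow]); the sum over i is then the iterate formula for (b_k a)_q w. *)
Lemma skewY_commutator (b : V) (k m : int) (w : U) (a : V) (J : nat) :
  (forall i, (J <= i)%N -> YU b i%:Z w = 0) ->
  YU b k (skewY rhoU YU w m a) - skewY rhoU YU w m (YV b k a)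
  = \sum_(i < J) binz K k i *: skewY rhoU YU (YU b i%:Z w) (m + k - i%:Z) a.
Proof.
move=> bJ.
have [N1 h1] := modes_trunc_nat truncU a w m.
have [N2 h2] := modes_trunc_nat truncU (YV b k a) w m.
(* The vectors $b_j w$ need their own truncation bounds; a common one exists because only $j<J$ give
   nonzero vectors. *)
have /choice[N3 h3] : forall j : nat, exists N, forall i, (N <= i)%N ->
    YU a (m + k - j%:Z + i%:Z) (YU b j%:Z w) = 0.
  by move=> j; exact: modes_trunc_nat.
pose N := maxn (maxn N1 N2) (maxn J (\max_(j < J) N3 j)).
have JN : (J <= N)%N by rewrite /N; lia.
have a0 i : (N <= i)%N -> YU a (m + i%:Z) w = 0.
  by move=> Ni; apply: h1; move: Ni; rewrite /N; lia.
have ba0 i : (N <= i)%N -> YU (YV b k a) (m + i%:Z) w = 0.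
  by move=> Ni; apply: h2; move: Ni; rewrite /N; lia.
have ab0 (j i : nat) : (N <= i)%N ->
    YU a (m + k - j%:Z + i%:Z) (YU b j%:Z w) = 0.
  move=> Ni; have [jJ|Jj] := ltnP j J; last by rewrite bJ // modes0.
  apply: h3; have := @leq_bigmax 'I_J (fun j => N3 j) (Ordinal jJ) => /= N3j.
  by rewrite (leq_trans N3j) // (leq_trans _ Ni) // /N !leq_max leqnn !orbT.
have bN i : (N <= i)%N -> YU b i%:Z w = 0.
  by move=> Ni; rewrite bJ // (leq_trans JN).
have sgnD x (i : nat) : (-1) ^ (x + i%:Z) = (-1) ^ x * (-1) ^+ i :> K.
  by rewrite expfzDr ?oppr_eq0 ?oner_eq0.
rewrite (skewY_trunc ba0) (skewY_trunc a0).
have [f hf] := modes_linear bilU b k.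
(* Here [i] is the binomial index of [modes_dpow] and [l] the power of $D$ left over, so the
   original power is [l + i]. *)
pose G i l := ((-1) ^ (m + (l + i)%N%:Z + 1) * binz K k i) *:
  dpow D l (YU b (k - i%:Z) (YU a (m + (l + i)%N%:Z) w)).
have -> : YU b k (\sum_(l < N) (-1) ^ (m + l%:Z + 1) *:
              dpow D l (YU a (m + l%:Z) w))
   = \sum_(l < N) \sum_(i < N) G i l.
  rewrite -sum_triangle; last first.
    by move=> i l Ni; rewrite /G a0 ?(modes0 bilU) ?linear0 ?scaler0 // addnC.
  rewrite hf linear_sum; apply: eq_bigr => l _.
  rewrite linearZ /= -hf modes_dpow scaler_sumr; apply: eq_bigr => i _.
  by rewrite /G subnK ?scalerA // -ltnS.
rewrite (@sum_ord_trunc _ (fun i => binz K k i *: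
  skewY rhoU YU (YU b i%:Z w) (m + k - i%:Z) a) J N) //;
  last by move=> i Ji; rewrite bJ // skewY0l scaler0.
under [RHS]eq_bigr => i _ do rewrite (skewY_trunc (ab0 i)) scaler_sumr.
rewrite [RHS]exchange_big -sumrB; apply: eq_bigr => l _ /=.
rewrite (@borcherds_iterate b a k (m + l%:Z) w N) //; last first.
  by move=> i Ni; rewrite -addrA -PoszD a0 // (leq_trans Ni) // leq_addl.
rewrite linear_sum scaler_sumr -sumrB; apply: eq_bigr => i _.
(* The products $b_{k-i}a_{m+l+i}w$ cancel against the first half of the iterate formula for $(b_k
   a)_{m+l}w$; only the terms with $b_i w$ remain. *)
have combine (g : {linear U -> U}) (x z : U) (s e c r : K) :
    (s * e * c) *: g x - s *: g ((e * c) *: (x - r *: z))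
    = c *: ((s * e * r) *: g z).
  rewrite (linearZ_LR g) (linearB g) (linearZ_LR g) !scalerBr !scalerA !mulrA subKr.
  by congr (_ *: _); ring.
rewrite /G (_ : m + (l + i)%N%:Z = m + l%:Z + i%:Z); last by lia.
rewrite (_ : m + k - i%:Z + l%:Z = m + l%:Z + k - i%:Z); last by lia.
rewrite (_ : m + l%:Z + i%:Z + 1 = m + l%:Z + 1 + i%:Z); last by lia.
rewrite sgnD combine; congr (_ *: (_ *: _)).
rewrite (_ : m + l%:Z + k - i%:Z + 1 = m + l%:Z + 1 + - i%:Z + k); last by lia.
rewrite [RHS]expfzDr ?[X in _ = X * _]expfzDr ?oppr_eq0 ?oner_eq0 //.
by congr (_ * _ * _); rewrite expN1r abszN.
Qed.

End SkewModes.

(** * Submodules and central elements *)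

Section Submodules.
Variables (K : numFieldType) (V : lmodType K) (rho : hvir -> {linear V -> V}).

Lemma hgen_submodule (v : V) : hsubmodule rho (hgen rho v).
Proof.
split=> [S subS _|k u w hu hw S subS Sv|x u hu S subS Sv].
- exact: (hsub_zero subS).
- by apply: (hsub_lin subS); [exact: hu | exact: hw].
- by apply: (hsub_act subS); exact: hu.
Qed.

Lemma hgen_id (v : V) : hgen rho v v.
Proof. by []. Qed.

Variable S : set V.
Hypothesis subS : hsubmodule rho S.

Lemma hsubmoduleZ (k : K) (u : V) : S u -> S (k *: u).
Proof.
move=> Su; rewrite -[_ *: _]addr0; apply: (hsub_lin subS) => //.
exact: (hsub_zero subS).
Qed.

Lemma hsubmoduleD (u w : V) : S u -> S w -> S (u + w).
Proof. by move=> Su Sw; rewrite -[u]scale1r; exact: (hsub_lin subS). Qed.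

Lemma hsubmoduleB (u w : V) : S u -> S w -> S (u - w).
Proof. by move=> Su Sw; rewrite -scaleN1r addrC; exact: (hsub_lin subS). Qed.

Lemma hsubmodule_sum (N : nat) (F : 'I_N -> V) :
  (forall i, S (F i)) -> S (\sum_(i < N) F i).
Proof.
move=> SF; elim/big_ind: _ => //; [exact: (hsub_zero subS) | exact: hsubmoduleD].
Qed.

Lemma hsubmodule_dpow (x : hvir) (l : nat) (u : V) :
  S u -> S (dpow (rho x) l u).
Proof.
move=> Su; apply: hsubmoduleZ; elim: l => //= l; exact: (hsub_act subS).
Qed.

End Submodules.

(** An eigenspace of a central element is a submodule, hence everything as soon as it contains the
    generator. *)
Lemma hcentral_scalar (K : numFieldType) (V : lmodType K)
    (rho : hvir -> {linear V -> V}) (v : V) (x : hvir) (c : K) :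
  hmodule rho -> hgen rho v = setT ->
  (forall y, hbracket K x y = [::]) -> rho x v = c *: v ->
  forall a, rho x a = c *: a.
Proof.
move=> rep gen cent xv a.
have : hgen rho v a by rewrite gen.
move=> /(_ [set b | rho x b = c *: b]); apply=> //.
split=> [|k u w /= hu hw|y u /= hu].
- by rewrite /= linear0 scaler0.
- by rewrite linearP hu hw scalerDr !scalerA mulrC.
- have := rep x y u; rewrite /commutator cent big_nil hu linearZ /=.
  by move/subr0_eq.
Qed.

(** * The action of $\mathcal H$ and of the modes of $W$ on $v^0,v^1$ *)

Section Proposition.
Variables (K : numFieldType) (cL cLI : K).
Variables (V : lmodType K) (rhoV : hvir -> {linear V -> V}) (vac : V).
Variable YV : V -> int -> V -> V.
Hypothesis hV : irr_highest_weight cL cLI 0 0 rhoV vac.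
Hypothesis hVOA :
  vertex_operator_algebra cL YV vac (rhoV (hL (- 2)) vac).
Hypothesis hYV : generating_fields rhoV vac rhoV YV.
Variables (U : lmodType K) (rhoU : hvir -> {linear U -> U}).
Variables (j : {linear 'rV[K]_2 -> U}) (YU : V -> int -> U -> U).
Hypothesis hU : is_calU cL cLI rhoU j.
Hypothesis hUmod : voa_module YV vac YU.
Hypothesis hYU : generating_fields rhoV vac rhoU YU.

Let va := voa_va hVOA.
Let derV := voa_derivative hVOA.
Let bilU := vm_bilinear hUmod.
Let truncU := vm_truncated hUmod.
Let om := rhoV (hL (- 2)) vac.
Let iv := rhoV (hI (- 1)) vac.
Let wv := Wvec rhoV cLI vac.
Local Notation v_ i := (j (vE K i)).

Lemma calU_nonneg (x : hvir) (e : 'rV[K]_2) :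
  hnonneg x -> rhoU x (j e) = j (actE cL cLI x e).
Proof.
move=> x0; have [_ [Et [rhoE [iota [p [ind hp _ _ jp]]]]]] := hU.
by rewrite !jp (ind_hom ind) // hp.
Qed.

Lemma calU_L_pos (n : int) (e : 'rV[K]_2) : 0 < n -> rhoU (hL n) (j e) = 0.
Proof.
by move=> n0; rewrite calU_nonneg /= ?ltW // gt_eqF // linear0.
Qed.

Lemma calU_I_pos (n : int) (e : 'rV[K]_2) : 0 < n -> rhoU (hI n) (j e) = 0.
Proof.
by move=> n0; rewrite calU_nonneg /= ?ltW // gt_eqF // linear0.
Qed.

Lemma calU_L0 (e : 'rV[K]_2) : rhoU (hL 0) (j e) = j e.
Proof. by rewrite calU_nonneg. Qed.

Lemma calU_I0_0 : rhoU (hI 0) (v_ 0) = 0.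
Proof. by rewrite calU_nonneg //= mxE /= scale0r linear0. Qed.

Lemma calU_I0_1 : rhoU (hI 0) (v_ 1) = v_ 0.
Proof. by rewrite calU_nonneg //= mxE /= scale1r. Qed.

Lemma calU_I0_I0 (i : 'I_2) : rhoU (hI 0) (rhoU (hI 0) (v_ i)) = 0.
Proof.
rewrite (calU_nonneg (x := hI 0)) // [actE _ _ _ _]/= linearZ linearZ /=.
by rewrite calU_I0_0 scaler0.
Qed.

Lemma modes_om (k : int) (u : U) : YU om k u = rhoU (hL (k - 1)) u.
Proof. by rewrite -hYU.1 subrK. Qed.

Lemma modes_iv (k : int) (u : U) : YU iv k u = rhoU (hI k) u.
Proof. exact: hYU.2. Qed.

Let om0 (u : U) : YU om 0 u = rhoU (hL (- 1)) u.
Proof. exact: modes_om. Qed.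

(** Write $W=I_{-1}I+2c_{L,I}I_{-2}\mathbf 1$ with $I=I(-1)\mathbf 1$. As $I(n)$ kills the image of
    $E$ for $n>0$ and $k\ge0$, only the term $i=0$ of the iterate formula survives;
    [modes_translate] handles the second summand. *)
Lemma modes_Wvec (k : nat) (e : 'rV[K]_2) :
  YU wv k%:Z (j e)
  = rhoU (hI (- 1)) (rhoU (hI k%:Z) (j e))
    + rhoU (hI (k%:Z - 1)) (rhoU (hI 0) (j e))
    - (2%:R * k%:R * cLI) *: rhoU (hI (k%:Z - 1)) (j e).
Proof.
have -> : wv = YV iv (- 1) iv + (2%:R * cLI) *: YV iv (- 2) vac.
  by rewrite /iv !hYV.2.
have [f hf] := modes_linearl bilU k%:Z (j e).
rewrite hf linearD linearZ /= -!hf (modes_translate hUmod).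
rewrite (@borcherds_iterate _ _ _ _ _ _ hUmod _ _ _ _ _ 1); last 2 first.
- by move=> i i1; rewrite modes_iv calU_I_pos //; lia.
- by move=> i i1; rewrite modes_iv calU_I_pos //; lia.
rewrite big_ord1 binz0 mulr1 scale1r !modes_iv exprN1 invrN1 scaleN1r opprK.
congr (rhoU (hI _) (rhoU (hI _) _) + rhoU (hI _) _ + _) => /=; [lia..|].
by rewrite scalerA rmorphN mulrN scaleNr mulrAC.
Qed.

Lemma modes_Wvec_ge2 (k : nat) (i : 'I_2) : (2 <= k)%N -> YU wv k%:Z (v_ i) = 0.
Proof.
move=> k2; rewrite modes_Wvec (calU_I_pos (n := k%:Z)) ?linear0; last by lia.
rewrite (calU_nonneg (x := hI 0)) // calU_I_pos; last by lia.
by rewrite calU_I_pos ?scaler0 ?addr0 ?subr0 //; lia.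
Qed.

Lemma modes_Wvec0_0 : YU wv 0 (v_ 0) = 0.
Proof.
rewrite (modes_Wvec 0) calU_I0_0 !linear0 mulr0n mulr0 mul0r scale0r.
by rewrite subr0 addr0.
Qed.

Lemma modes_Wvec1_0 : YU wv 1 (v_ 0) = 0.
Proof.
rewrite (modes_Wvec 1) (calU_I_pos (n := 1)) // !linear0 subrr.
by rewrite !calU_I0_0 linear0 scaler0 subr0 addr0.
Qed.

Lemma modes_Wvec1_1 : YU wv 1 (v_ 1) = (- (2%:R * cLI)) *: v_ 0.
Proof.
rewrite (modes_Wvec 1) (calU_I_pos (n := 1)) // linear0 subrr.
by rewrite calU_I0_I0 calU_I0_1 !add0r mulr1 scaleNr.
Qed.

(** * Commutators with $L(n)$ and $I(n)$ *)

Let skewc J b k m w a := @skewY_commutator _ _ _ _ _ _ _ _ va derV hUmod om0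
  b k m w a J.
Let skewd := skewY_derivative va derV hUmod om0.

(** Only $\omega_0=L(-1)$ and $\omega_1=L(0)$ contribute, with coefficients $-(m+n+1)$ and $n+1$;
    weight one of $v^i$ makes them add up to $-m$. *)
Lemma skewY_L (i : 'I_2) (n m : int) (a : V) :
  rhoU (hL n) (skewY rhoU YU (v_ i) m a)
  - skewY rhoU YU (v_ i) m (rhoV (hL n) a)
  = (- m)%:~R *: skewY rhoU YU (v_ i) (n + m) a.
Proof.
rewrite -hYU.1 -[rhoV (hL n) a]hYV.1 (@skewc 2); last first.
  by move=> k k2; rewrite modes_om calU_L_pos //; lia.
rewrite big_ord_recl big_ord1 /= !modes_om (_ : 0%:Z - 1 = - 1) //.
rewrite (_ : 1%:Z - 1 = 0) // calU_L0 skewd binz0 binz1 scale1r.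
rewrite (_ : m + (n + 1) - 0%:Z - 1 = n + m); last by lia.
rewrite (_ : m + (n + 1) - 1%:Z = n + m); last by lia.
by rewrite -scalerDl -rmorphD; congr (_%:~R *: _); lia.
Qed.

Lemma skewY_I1 (n m : int) (a : V) :
  rhoU (hI n) (skewY rhoU YU (v_ 1) m a)
  - skewY rhoU YU (v_ 1) m (rhoV (hI n) a)
  = skewY rhoU YU (v_ 0) (m + n) a.
Proof.
rewrite -hYU.2 -[rhoV (hI n) a]hYV.2 (@skewc 1); last first.
  by move=> k k1; rewrite modes_iv calU_I_pos //; lia.
by rewrite big_ord1 binz0 scale1r modes_iv calU_I0_1 subr0.
Qed.

(** * Stability of submodules and the image of $S_1(0)$ *)

Lemma highest_weight_ind (S : set V) :
  (forall k u v, S u -> S v -> S (k *: u + v)) ->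
  (forall n a, S a -> S (rhoV (hL n) a)) ->
  (forall n a, S a -> S (rhoV (hI n) a)) ->
  S vac -> forall a, S a.
Proof.
move=> Slin SL SI Svac a.
have S0 : S 0 by rewrite -(subrr vac) addrC -scaleN1r; exact: Slin.
(* Central elements act on $V$ by scalars, so closure under them follows from closure under linear
   combinations. *)
have scal x c : (forall y, hbracket K x y = [::]) -> rhoV x vac = c *: vac ->
    forall b, S b -> S (rhoV x b).
  move=> cent xv b Sb.
  rewrite (hcentral_scalar (ihw_module hV) (ihw_gen hV) cent xv).
  by rewrite -[_ *: _]addr0; exact: Slin.
have : hgen rhoV vac a by rewrite (ihw_gen hV).
move=> /(_ S); apply=> //; split=> // -[n|n|||]; [exact: SL|exact: SI|..].
- by apply: (scal _ _ _ (ihw_CL hV)); case.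
- by apply: (scal _ _ _ (ihw_CLI hV)); case.
- by apply: (scal _ 0); [case | rewrite scale0r (ihw_CI hV)].
Qed.

(** The modes of the two generating fields act through [rhoU]; the iterate formula carries stability
    from $a'$ to $b_k a'$, and such products, starting from the vacuum, span $V$. *)
Lemma hsubmodule_modes (G : set U) (a : V) (n : int) (u : U) :
  hsubmodule rhoU G -> G u -> G (YU a n u).
Proof.
move=> subG; move: n u; pose S a := forall n u, G u -> G (YU a n u).
have step b k a' : (forall q u, G u -> G (YU b q u)) -> S a' -> S (YV b k a').
  move=> Gb Sa n u Gu.
  have [N1 h1] := modes_trunc_nat truncU a' u n.
  have [N2 h2] := modes_trunc_nat truncU b u 0.
  rewrite (@borcherds_iterate _ _ _ _ _ _ hUmod _ _ _ _ _ (maxn N1 N2)); last 2 first.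
  - by move=> i Ni; rewrite h1 // (leq_trans _ Ni) // leq_maxl.
  - by move=> i Ni; rewrite -[i%:Z]add0r h2 // (leq_trans _ Ni) // leq_maxr.
  apply: (hsubmodule_sum subG) => i; apply: (hsubmoduleZ subG).
  apply: (hsubmoduleB subG); first by apply: Gb; exact: Sa.
  by apply: (hsubmoduleZ subG); apply: Sa; exact: Gb.
apply: (highest_weight_ind (S := S)).
- move=> k b c Sb Sc n u Gu; rewrite bilU.1.
  by apply: (hsub_lin subG); [exact: Sb | exact: Sc].
- move=> k b; rewrite -hYV.1; apply: step => q u.
  by rewrite modes_om; exact: (hsub_act subG).
- move=> k b; rewrite -hYV.2; apply: step => q u.
  by rewrite modes_iv; exact: (hsub_act subG).
- move=> n u Gu; rewrite (vm_vacuum hUmod); case: eqP => // _.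
  exact: (hsub_zero subG).
Qed.

Lemma hsubmodule_skewY (G : set U) (a : V) (n : int) (u : U) :
  hsubmodule rhoU G -> G u -> G (skewY rhoU YU u n a).
Proof.
move=> subG Gu; have [N h] := modes_trunc_nat truncU a u n.
rewrite (skewY_trunc rhoU h); apply: (hsubmodule_sum subG) => l.
apply: (hsubmoduleZ subG); apply: (hsubmodule_dpow subG).
exact: hsubmodule_modes.
Qed.

Lemma skewY_screening_vac : skewY rhoU YU (v_ 1) 0 vac = 0.
Proof.
rewrite (skewY_trunc rhoU (N := 0)) ?big_ord0 // => i _.
by rewrite (vm_vacuum hUmod) add0r.
Qed.

Lemma skewY_screening_iv : skewY rhoU YU (v_ 1) 0 iv = - v_ 0.
Proof.
rewrite (skewY_trunc rhoU (N := 1)).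
  (* Only $I(0)v^1=v^0$ survives, with the sign $(-1)^{0+0+1}$. *)
  by rewrite big_ord1 dpow0 modes_iv !addr0 calU_I0_1 add0r expr1z scaleN1r.
by move=> i i1; rewrite modes_iv calU_I_pos //; lia.
Qed.

Lemma skewY_screening_range (a : V) :
  hgen rhoU (v_ 0) (skewY rhoU YU (v_ 1) 0 a).
Proof.
set G := hgen rhoU (v_ 0).
have subG : hsubmodule rhoU G by exact: hgen_submodule.
apply: (highest_weight_ind (S := fun a => G (skewY rhoU YU (v_ 1) 0 a))).
- move=> k b c Gb Gc; rewrite (skewY_linear rhoU hUmod).
  exact: (hsub_lin subG).
- move=> n b Gb; have := skewY_L 1 n 0 b.
  by rewrite oppr0 scale0r => /subr0_eq <-; exact: (hsub_act subG).
(* $S_1(0)I(n)b=I(n)S_1(0)b-S_0(n)b$, where $S_0(n)b$ lies in [G] because $v^0$ does. *)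
- move=> n b Gb; pose u := skewY rhoU YU (v_ 1) 0 b.
  rewrite -[skewY _ _ _ _ _](subKr (rhoU (hI n) u)) skewY_I1.
  apply: (hsubmoduleB subG); first exact: (hsub_act subG).
  by apply: (hsubmodule_skewY _ _ subG); exact: hgen_id.
- by rewrite skewY_screening_vac; exact: (hsub_zero subG).
Qed.

(** * Operators on the extension and the lift of $S_1(0)$ *)

Lemma SextE (i : 'I_2) (n : int) (x : V * U) :
  Sext rhoU YV YU j i n x = (0, skewY rhoU YU (v_ i) n x.1).
Proof.
by rewrite /Sext /Yext (modes0l (va_bilinear va)) (modes0l bilU) add0r.
Qed.

Lemma WextE (n : int) (x : V * U) :
  Wext rhoV rhoU YV YU cLI vac n x = (YV wv (n + 1) x.1, YU wv (n + 1) x.2).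
Proof. by rewrite /Wext /Yext (skewY0l rhoU hUmod) addr0. Qed.

Lemma Lext_Sext_commutator (i : 'I_2) (n m : int) (x : V * U) :
  commutator (Lext rhoV rhoU n) (Sext rhoU YV YU j i m) x
  = (- m)%:~R *: Sext rhoU YV YU j i (n + m) x.
Proof.
rewrite /commutator !SextE /Lext /= linear0; congr pair => /=.
  by rewrite subr0 scaler0.
exact: skewY_L.
Qed.

(** The image of $S_1(0)$ lies in the range of the injective [f], so the map factors, and
    injectivity makes the factor linear. It is nonzero at $I(-1)\mathbf 1$ because $v^0\ne0$. *)
Lemma skewY_screening_lift (M : lmodType K) (rhoM : hvir -> {linear M -> M})
    (w : M) (f : {linear M -> U}) :
  irr_highest_weight cL cLI 1 0 rhoM w -> injective f ->
  range f = hgen rhoU (v_ 0) ->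
  exists s : {linear V -> M},
    (forall a, skewY rhoU YU (v_ 1) 0 a = f (s a)) /\ (exists a, s a != 0).
Proof.
move=> hM injf rf.
have /choice[s hs] : forall a, exists y, skewY rhoU YU (v_ 1) 0 a = f y.
  move=> a; have := skewY_screening_range a; rewrite -rf.
  by case=> y _ <-; exists y.
have lin_s : linear s.
  move=> k a b; apply: injf.
  by rewrite -hs (skewY_linear rhoU hUmod) linearP !hs.
exists (linear_pack lin_s); split; first exact: hs.
exists iv; apply/eqP => siv; have := hs iv.
rewrite -[s iv]/(linear_pack lin_s iv) siv linear0 skewY_screening_iv.
move=> /eqP; rewrite oppr_eq0 => /eqP v00.
(* If $v^0=0$ then $U(\mathcal H)v^0$ is zero, hence so is the range of [f], against $w\ne0$. *)
have fw0 : f w = 0.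
  have : range f (f w) by exists w.
  rewrite rf v00 => /(_ [set 0]); apply=> //.
  split=> //= [k u v -> ->|x u ->]; last by rewrite linear0.
  by rewrite scaler0 addr0.
by move: (ihw_neq0 hM); rewrite (injf w 0) ?eqxx // fw0 linear0.
Qed.

(** * The defining relation of $\mathcal U$ and commutators with $W(n)$ *)

Hypothesis cLI_neq0 : cLI != 0.

(** The generator of the kernel of [p] maps to zero; clearing $c_{L,I}^{-1}$ is where $c_{L,I}\ne0$
    enters. *)
Lemma calU_relation :
  rhoU (hI (- 1)) (v_ 0) = - cLI *: rhoU (hL (- 1)) (v_ 0).
Proof.
have [_ [Et [rhoE [iota [p [ind hp _ kerp jp]]]]]] := hU.
have : [set x | p x = 0] (rhoE (hL (- 1)) (iota (vE K 0))
                     + cLI^-1 *: rhoE (hI (- 1)) (iota (vE K 0))).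
  by rewrite kerp; exact: hgen_id.
rewrite /= linearD linearZ /= !hp -!jp => /eqP.
rewrite addr_eq0 => /eqP ->.
by rewrite scalerN scaleNr opprK scalerA divff // scale1r.
Qed.

Lemma modes_Wvec0_1 :
  YU wv 0 (v_ 1) = (- (2%:R * cLI)) *: rhoU (hL (- 1)) (v_ 0).
Proof.
rewrite (modes_Wvec 0) calU_I0_1 mulr0n mulr0 mul0r scale0r subr0.
rewrite (_ : 0%:Z - 1 = - 1) // calU_relation -scalerDl; congr (_ *: _); ring.
Qed.

(** For $v^1$ both contributions are multiples of the field of $v^0$: $W_0v^1$ gives
    $2c_{L,I}(m+n+1)$ through [skewY_derivative], $W_1v^1$ gives $-2c_{L,I}(n+1)$, in total
    $2mc_{L,I}$. *)
Lemma skewY_W (i : 'I_2) (n m : int) (a : V) :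
  YU wv (n + 1) (skewY rhoU YU (v_ i) m a)
  - skewY rhoU YU (v_ i) m (YV wv (n + 1) a)
  = (if i == 0 then 0
     else (2%:R * m%:~R * cLI) *: skewY rhoU YU (v_ 0) (n + m) a).
Proof.
rewrite (@skewc 2); last by move=> k k2; exact: modes_Wvec_ge2.
rewrite big_ord_recl big_ord1 /= binz0 binz1 scale1r.
have [->|i1] := eqVneq i 0.
  by rewrite modes_Wvec0_0 modes_Wvec1_0 !(skewY0l rhoU hUmod) scaler0 addr0.
have -> : i = 1 by case: i i1 => -[|[|]] // lt2 _; exact: val_inj.
rewrite modes_Wvec0_1 modes_Wvec1_1 !(skewYZl rhoU hUmod) skewd.
rewrite (_ : m + (n + 1) - 0%:Z - 1 = n + m); last by lia.
rewrite (_ : m + (n + 1) - 1%:Z = n + m); last by lia.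
rewrite !scalerA -scalerDl; congr (_ *: _).
by rewrite subr0 !(rmorphN, rmorphD) /=; ring.
Qed.

Lemma Wext_Sext_commutator (i : 'I_2) (n m : int) (x : V * U) :
  commutator (Wext rhoV rhoU YV YU cLI vac n) (Sext rhoU YV YU j i m) x
  = (if i == 0 then 0
     else (2%:R * m%:~R * cLI) *: Sext rhoU YV YU j 0 (n + m) x).
Proof.
rewrite /commutator !SextE !WextE /= (modes0 (va_bilinear va)).
have := skewY_W i n m x.1; case: ifP => _ h; congr pair => //=.
- by rewrite subrr.
- by rewrite subrr scaler0.
Qed.

End Proposition.

Theorem proposition4p2 (R : realType) (cL cLI : R[i]) (hcLI : cLI != 0)
  (* V = L^H(c_L, c_{L,I}), a vertex operator algebra *)
  (V : lmodType R[i]) (rhoV : hvir -> {linear V -> V}) (vac : V)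
  (YV : V -> int -> V -> V)
  (hV : irr_highest_weight cL cLI 0 0 rhoV vac)
  (hVOA : vertex_operator_algebra cL YV vac (rhoV (hL (- 2)) vac))
  (hYV : generating_fields rhoV vac rhoV YV)
  (* the H-module U, as a V-module *)
  (U : lmodType R[i]) (rhoU : hvir -> {linear U -> U})
  (j : {linear 'rV[R[i]]_2 -> U}) (YU : V -> int -> U -> U)
  (hU : is_calU cL cLI rhoU j)
  (hUmod : voa_module YV vac YU)
  (hYU : generating_fields rhoV vac rhoU YU) :
  let L := Lext rhoV rhoU in
  let W := Wext rhoV rhoU YV YU cLI vac in
  let S := Sext rhoU YV YU j in
  [/\ forall (i : 'I_2) (n m : int) (x : V * U),
        commutator (L n) (S i m) x = (- m)%:~R *: S i (n + m) x,
      forall (n m : int) (x : V * U), commutator (W n) (S 0 m) x = 0,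
      forall (n m : int) (x : V * U),
        commutator (W n) (S 1 m) x
        = (2%:R * m%:~R * cLI) *: S 0 (n + m) x,
      forall (i : 'I_2) (n : int) (x : V * U),
        commutator (L n) (S i 0) x = 0 /\ commutator (W n) (S i 0) x = 0
    & (* S_1(0) maps V to U(H) v^0 and I(-1) vac to - v^0 *)
      [/\ forall a : V, exists2 u : U,
            hgen rhoU (j (vE _ 0)) u & S 1 0 (a, 0) = (0, u),
          S 1 0 (rhoV (hI (- 1)) vac, 0) = (0, - j (vE _ 0))
        & (* under any identification f of L^H(1,0) with U(H) v^0,
             S_1(0) is a nonzero map V -> L^H(1,0) *)
          forall (M : lmodType R[i]) (rhoM : hvir -> {linear M -> M}) (w : M)
            (f : {linear M -> U}),
            irr_highest_weight cL cLI 1 0 rhoM w ->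
            hhom rhoM rhoU f -> injective f ->
            range f = hgen rhoU (j (vE _ 0)) ->
            exists s : {linear V -> M},
              (forall a : V, S 1 0 (a, 0) = (0, f (s a))) /\
              (exists a : V, s a != 0)]].
Proof.
move=> L W S; split.
- by move=> i n m x; exact: (Lext_Sext_commutator hVOA hYV hU hUmod hYU).
- by move=> n m x; exact: (Wext_Sext_commutator hVOA hYV hU hUmod hYU hcLI).
- by move=> n m x; exact: (Wext_Sext_commutator hVOA hYV hU hUmod hYU hcLI).
- move=> i n x; split.
    rewrite (Lext_Sext_commutator hVOA hYV hU hUmod hYU) //.
    by rewrite oppr0 scale0r.
  rewrite (Wext_Sext_commutator hVOA hYV hU hUmod hYU hcLI) //.
  by case: ifP; rewrite // mulr0 mul0r scale0r.
- split.
  + move=> a; exists (skewY rhoU YU (j (vE _ 1)) 0 a).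
      exact: (skewY_screening_range hV hVOA hYV hU hUmod hYU).
    by rewrite /S (SextE hVOA _ _ hUmod).
  + rewrite /S (SextE hVOA _ _ hUmod).
    by rewrite (skewY_screening_iv hU hYU).
  + move=> M rhoM w f hM _ injf rf.
    have [s [hs s0]] := skewY_screening_lift hV hVOA hYV hU hUmod hYU hM
      injf rf.
    by exists s; split=> // a; rewrite /S (SextE hVOA _ _ hUmod) hs.
Qed.
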